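(* The problem Forget is undecidable.
   Context: Temporal Datalog. Constants are partitioned into objects and integer time points; variables into object variables and time variables. A time term is a time point, a time variable, or an expression $t+k$ with $t$ a time variable and $k\in\mathbb{Z}$. Each predicate is either extensional (EDB) or intensional (IDB) and has an arity $n\ge0$, each position being of object sort or time sort; a predicate is rigid if all its positions are of object sort, and temporal if its last position is of time sort and all others are of object sort. An atom $P(t_1,\dots,t_n)$ has terms of the required sorts. A rule is $\bigwedge_i\alpha_i\to\alpha$ with $\alpha$ and all $\alpha_i$ rigid or temporal atoms, $\alpha$ IDB whenever the body is nonempty, and every head variable occurring in the body. A program is a finite set of rules. A fact is a ground rigid or temporal atom without $+$ (identified with the rule $\top\to\alpha$); a dataset is a finite set of EDB facts. Rules are read as universally quantified first-order sentences with $+$ interpreted as integer addition; $\Pi\models\alpha$ denotes entailment. A query is $Q=\langle P_Q,\Pi_Q\rangle$ with $\Pi_Q$ a program and $P_Q$ an IDB predicate of $\Pi_Q$; it is temporal if $P_Q$ is temporal. For a temporal query $Q$, dataset $D$ and time point $\tau$, $Q(D,\tau)$ is the set of tuples of objects $\vec o$ with $\Pi_Q\cup D\models P_Q(\vec o,\tau)$. For a dataset $D$ and time point $\tau$, $D[\tau]$ is the set of all rigid facts of $D$ together with the temporal facts of $D$ whose time argument is $>\tau$. A $\tau_{in}$-history is a dataset consisting of rigid facts and temporal facts with time argument $\le\tau_{in}$; a $\tau_{in}$-update is a dataset consisting of temporal facts with time argument $>\tau_{in}$. Forget: an instance is $\langle Q,D,\tau_{in},\tau_{out},\tau_{mem}\rangle$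 with $Q$ a temporal query, $D$ a $\tau_{in}$-history and $\tau_{mem}\le\tau_{out}\le\tau_{in}$; Forget holds for it iff $Q(D\cup U,\tau)=Q(D[\tau_{mem}]\cup U,\tau)$ for every $\tau_{in}$-update $U$ and every time point $\tau\ge\tau_{out}$. *)

(* Defs.v *)
From Stdlib Require Import ZArith List Bool.
Import ListNotations.
Open Scope Z_scope.

(* Object constants are [nat], time points are [Z].  Object variables
   and time variables are two disjoint copies of [nat]. *)

(* A predicate that may occur in rules/facts is rigid or temporal.
   [p_arity] is the number of object positions; if [p_temporal] is true
   there is one additional (last) position of time sort. *)
Record pred : Type := MkPred {
  p_id : nat;
  p_edb : bool;          (* true = extensional (EDB), false = IDB *)
  p_arity : nat;
  p_temporal : bool
}.

Inductive oterm : Type :=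
| OConst (o : nat)
| OVar (x : nat).

Inductive tterm : Type :=
| TConst (t : Z)
| TVar (x : nat)
| TShift (x : nat) (k : Z).

Record atom : Type := MkAtom {
  a_pred : pred;
  a_args : list oterm;
  a_time : option tterm
}.

Definition wf_atom (a : atom) : Prop :=
  length (a_args a) = p_arity (a_pred a) /\
  (match a_time a with
   | None => p_temporal (a_pred a) = false
   | Some _ => p_temporal (a_pred a) = true
   end).

Record rule : Type := MkRule {
  r_body : list atom;
  r_head : atom
}.

Definition program := list rule.

Definition ovars_of (a : atom) : list nat :=
  flat_map (fun t => match t with OVar x => [x] | OConst _ => [] end) (a_args a).

Definition tvars_of (a : atom) : list nat :=
  match a_time a with
  | Some (TVar x) => [x]
  | Some (TShift x _) => [x]
  | _ => []
  end.

Definition wf_rule (r : rule) : Prop :=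
  wf_atom (r_head r) /\
  (forall b, In b (r_body r) -> wf_atom b) /\
  (r_body r <> [] -> p_edb (a_pred (r_head r)) = false) /\
  (forall x, In x (ovars_of (r_head r)) -> exists b, In b (r_body r) /\ In x (ovars_of b)) /\
  (forall x, In x (tvars_of (r_head r)) -> exists b, In b (r_body r) /\ In x (tvars_of b)).

Definition wf_program (P : program) : Prop := forall r, In r P -> wf_rule r.

Definition is_fact (a : atom) : Prop :=
  wf_atom a /\
  (forall t, In t (a_args a) -> exists o, t = OConst o) /\
  (match a_time a with
   | None => True
   | Some (TConst _) => True
   | Some _ => False
   end).

Definition dataset := list atom.

Definition is_dataset (D : dataset) : Prop :=
  forall a, In a D -> is_fact a /\ p_edb (a_pred a) = true.

Definition fact_rule (a : atom) : rule := MkRule [] a.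

Definition prog_with (P : program) (D : dataset) : program :=
  P ++ map fact_rule D.

Definition gatom : Type := (pred * list nat * option Z)%type.

Record subst : Type := MkSubst { s_obj : nat -> nat; s_time : nat -> Z }.

Definition inst_oterm (s : subst) (t : oterm) : nat :=
  match t with OConst o => o | OVar x => s_obj s x end.

Definition inst_tterm (s : subst) (t : tterm) : Z :=
  match t with
  | TConst c => c
  | TVar x => s_time s x
  | TShift x k => s_time s x + k
  end.

Definition inst_atom (s : subst) (a : atom) : gatom :=
  (a_pred a, map (inst_oterm s) (a_args a), option_map (inst_tterm s) (a_time a)).

Definition interp := gatom -> Prop.

Definition is_model (P : program) (I : interp) : Prop :=
  forall r s, In r P ->
    (forall b, In b (r_body r) -> I (inst_atom s b)) -> I (inst_atom s (r_head r)).

Definition entails (P : program) (g : gatom) : Prop :=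
  forall I : interp, is_model P I -> I g.

Record query : Type := MkQuery { q_pred : pred; q_prog : program }.

Definition pred_occurs (p : pred) (P : program) : Prop :=
  exists r, In r P /\ (a_pred (r_head r) = p \/ exists b, In b (r_body r) /\ a_pred b = p).

Definition is_query (Q : query) : Prop :=
  wf_program (q_prog Q) /\ p_edb (q_pred Q) = false /\ pred_occurs (q_pred Q) (q_prog Q).

Definition is_temporal_query (Q : query) : Prop :=
  is_query Q /\ p_temporal (q_pred Q) = true.

Definition answers (Q : query) (D : dataset) (tau : Z) (o : list nat) : Prop :=
  length o = p_arity (q_pred Q) /\
  entails (prog_with (q_prog Q) D) (q_pred Q, o, Some tau).

Definition keep_after (tau : Z) (a : atom) : bool :=
  match a_time a with
  | None => true
  | Some (TConst t) => Z.ltb tau t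
  | Some _ => false
  end.

Definition restrict (D : dataset) (tau : Z) : dataset := filter (keep_after tau) D.

Definition is_history (tin : Z) (D : dataset) : Prop :=
  is_dataset D /\
  forall a, In a D ->
    match a_time a with
    | None => True
    | Some (TConst t) => t <= tin
    | Some _ => False
    end.

Definition is_update (tin : Z) (U : dataset) : Prop :=
  is_dataset U /\
  forall a, In a U ->
    match a_time a with
    | Some (TConst t) => tin < t
    | _ => False
    end.

Record forget_instance : Type := MkFI {
  fi_query : query;
  fi_data : dataset;
  fi_tin : Z;
  fi_tout : Z;
  fi_tmem : Z
}.

Definition valid_instance (I : forget_instance) : Prop :=
  is_temporal_query (fi_query I) /\
  is_history (fi_tin I) (fi_data I) /\
  fi_tmem I <= fi_tout I /\ fi_tout I <= fi_tin I.

Definition forget_holds (I : forget_instance) : Prop :=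
  forall U, is_update (fi_tin I) U ->
  forall tau, fi_tout I <= tau ->
  forall o, answers (fi_query I) (fi_data I ++ U) tau o <->
            answers (fi_query I) (restrict (fi_data I) (fi_tmem I) ++ U) tau o.

Open Scope nat_scope.

Definition cpair (a b : nat) : nat := (a + b) * (a + b + 1) / 2 + b.

Definition enc_bool (b : bool) : nat := if b then 1 else 0.

Definition enc_Z (z : Z) : nat :=
  match z with
  | Z0 => 0
  | Zpos p => 2 * Pos.to_nat p
  | Zneg p => 2 * Pos.to_nat p - 1
  end.

Fixpoint enc_list {A : Type} (e : A -> nat) (l : list A) : nat :=
  match l with
  | [] => 0
  | x :: l' => S (cpair (e x) (enc_list e l'))
  end.

Definition enc_option {A : Type} (e : A -> nat) (o : option A) : nat :=
  match o with None => 0 | Some x => S (e x) end.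

Definition enc_pred (p : pred) : nat :=
  cpair (p_id p) (cpair (enc_bool (p_edb p)) (cpair (p_arity p) (enc_bool (p_temporal p)))).

Definition enc_oterm (t : oterm) : nat :=
  match t with OConst o => cpair 0 o | OVar x => cpair 1 x end.

Definition enc_tterm (t : tterm) : nat :=
  match t with
  | TConst c => cpair 0 (enc_Z c)
  | TVar x => cpair 1 x
  | TShift x k => cpair 2 (cpair x (enc_Z k))
  end.

Definition enc_atom (a : atom) : nat :=
  cpair (enc_pred (a_pred a)) (cpair (enc_list enc_oterm (a_args a)) (enc_option enc_tterm (a_time a))).

Definition enc_rule (r : rule) : nat :=
  cpair (enc_list enc_atom (r_body r)) (enc_atom (r_head r)).

Definition enc_query (Q : query) : nat :=
  cpair (enc_pred (q_pred Q)) (enc_list enc_rule (q_prog Q)).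

Definition enc_instance (I : forget_instance) : nat :=
  cpair (enc_query (fi_query I))
    (cpair (enc_list enc_atom (fi_data I))
      (cpair (enc_Z (fi_tin I)) (cpair (enc_Z (fi_tout I)) (enc_Z (fi_tmem I))))).

Inductive prf : Type :=
| PZero : prf
| PSucc : prf
| PProj : nat -> prf
| PComp : prf -> list prf -> prf
| PRec : prf -> prf -> prf
| PMu : prf -> prf.

Inductive eval : prf -> list nat -> nat -> Prop :=
| ev_zero v : eval PZero v 0
| ev_succ n v : eval PSucc (n :: v) (S n)
| ev_proj i v x : nth_error v i = Some x -> eval (PProj i) v x
| ev_comp f gs v ws y : evals gs v ws -> eval f ws y -> eval (PComp f gs) v y
| ev_rec0 f g v y : eval f v y -> eval (PRec f g) (0 :: v) y
| ev_recS f g n v r y :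
    eval (PRec f g) (n :: v) r -> eval g (n :: r :: v) y -> eval (PRec f g) (S n :: v) y
| ev_mu f v y :
    eval f (y :: v) 0 ->
    (forall z, z < y -> exists m, eval f (z :: v) (S m)) ->
    eval (PMu f) v y
with evals : list prf -> list nat -> list nat -> Prop :=
| evs_nil v : evals [] v []
| evs_cons g gs v w ws : eval g v w -> evals gs v ws -> evals (g :: gs) v (w :: ws).

Definition forget_decidable : Prop :=
  exists f : prf, forall I : forget_instance, valid_instance I ->
    (forget_holds I -> eval f [enc_instance I] 1) /\
    (~ forget_holds I -> eval f [enc_instance I] 0).

(* Main.v *)
(* Partial recursive functions are compiled to Datalog: objects name numbers, a fact
   [val x t] of the update saying that [x] names [t - 1], and rigid predicates define
   the graphs of the functions by their recursion equations. An update whose naming is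
   ambiguous is detected thanks to the order of time and yields all answers with or
   without the history; an unambiguous one only yields correct function values; and an
   update naming enough numbers yields every given value. The history holds a single
   fact, placed at time [-n] and hence forgotten, without which the input [n] of the
   computation cannot be read. So Forget holds iff the compiled function does not take
   the value 1 at [n].

   Given a decider [f], let [s] map [c] to the code of the instance made of the query
   with code [c] and of the input [c]. Compiling [f o s] and taking for [n] the code of
   the resulting query gives an instance on which [f] takes the value 1 iff Forget
   fails. Putting [n] in the history, and not in the query, makes this diagonalization
   possible without a universal machine or a recursion theorem. *)

Require Import Defs.
From Stdlib Require Import ZArith List Lia Cantor Classical.
Import ListNotations.
Local Open Scope nat_scope.

(** * Partial recursive functions *)

(** The list inside [PComp] is nested, so a usable induction must supply the hypothesis for each of
    its members. *)
Lemma prf_list_ind (P : prf -> Prop) :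
  P PZero -> P PSucc -> (forall i, P (PProj i)) ->
  (forall f gs, P f -> Forall P gs -> P (PComp f gs)) ->
  (forall f g, P f -> P g -> P (PRec f g)) ->
  (forall f, P f -> P (PMu f)) -> forall f, P f.
Proof.
  intros HZ HS HP HC HR HM.
  fix IH 1. intros [| |i|f gs|f g|f];
    [exact HZ|exact HS|apply HP|apply HC|apply HR|apply HM]; try apply IH.
  induction gs as [|g gs IHgs]; constructor; [apply IH|exact IHgs].
Qed.

Lemma evals_Forall2 gs v ws :
  evals gs v ws <-> Forall2 (fun g w => eval g v w) gs ws.
Proof.
  split.
  - revert ws; induction gs; intros ws H; inversion H; subst; constructor; auto.
  - induction 1; constructor; auto.
Qed.

(** For minimization, if two results differed, the function would take both zero and a positive
    value at the smaller one. *)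
Lemma eval_fun f : forall v y y', eval f v y -> eval f v y' -> y = y'.
Proof.
  induction f as [| |i|f gs IHf IHgs|f g IHf IHg|f IHf] using prf_list_ind;
    intros v y y' H H'.
  - inversion H; inversion H'; congruence.
  - inversion H; inversion H'; congruence.
  - inversion H; inversion H'; congruence.
  - inversion H as [| | |? ? ? ws ? Hs Hf| | |]; subst.
    inversion H' as [| | |? ? ? ws' ? Hs' Hf'| | |]; subst.
    assert (ws = ws') as <-; [|eauto].
    clear - IHgs Hs Hs'. revert ws ws' Hs Hs'.
    induction IHgs as [|g gs Hg _ IH]; intros ws ws' Hs Hs';
      inversion Hs; inversion Hs'; subst; f_equal; eauto.
  - destruct v as [|n v]; [inversion H|].
    revert y y' H H'; induction n as [|n IHn]; intros y y' H H';
      inversion H; inversion H'; subst; eauto.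
    match goal with
    | H1 : eval (PRec f g) (n :: v) ?r, H2 : eval (PRec f g) (n :: v) ?r' |- _ =>
      assert (r = r') as <- by eauto
    end.
    eauto.
  - inversion H as [| | | | | |? ? ? H0 Hlt]; subst.
    inversion H' as [| | | | | |? ? ? H0' Hlt']; subst.
    destruct (Nat.lt_trichotomy y y') as [L|[L|L]]; [|assumption|].
    + destruct (Hlt' _ L) as [m Hm]. discriminate (IHf _ _ _ H0 Hm).
    + destruct (Hlt _ L) as [m Hm]. discriminate (IHf _ _ _ H0' Hm).
Qed.

(** * Arithmetic and pairing as partial recursive functions *)

Fixpoint prf_const (c : nat) : prf :=
  match c with 0 => PZero | S c => PComp PSucc [prf_const c] end.

Definition prf_succ (f : prf) : prf := PComp PSucc [f].
Definition prf_add : prf := PRec (PProj 0) (PComp PSucc [PProj 1]).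
(** [PRec] hands its step function the counter before the recursive value; returning the counter
    gives the truncated predecessor. *)
Definition prf_pred : prf := PRec PZero (PProj 0).
Definition prf_tri : prf := PRec PZero (PComp prf_add [prf_succ (PProj 0); PProj 1]).
Definition prf_cpair (f g : prf) : prf :=
  PComp prf_add [PComp prf_tri [PComp prf_add [f; g]]; g].

Lemma eval_comp1 f g v a y : eval g v a -> eval f [a] y -> eval (PComp f [g]) v y.
Proof. intros Hg Hf. eapply ev_comp; [|exact Hf]. repeat constructor; auto. Qed.

Lemma eval_comp2 f g h v a b y :
  eval g v a -> eval h v b -> eval f [a; b] y -> eval (PComp f [g; h]) v y.
Proof. intros Hg Hh Hf. eapply ev_comp; [|exact Hf]. repeat constructor; auto. Qed.

Lemma eval_succ f v a : eval f v a -> eval (prf_succ f) v (S a).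
Proof. intros H. eapply eval_comp1; [exact H|constructor]. Qed.

Lemma eval_const c v : eval (prf_const c) v c.
Proof. induction c as [|c IH]; [constructor|apply eval_succ, IH]. Qed.

Lemma eval_add a b : eval prf_add [a; b] (a + b).
Proof.
  induction a as [|a IH]; [repeat constructor|].
  eapply ev_recS; [exact IH|]. apply eval_succ. repeat constructor.
Qed.

Lemma eval_pred a : eval prf_pred [a] (a - 1).
Proof.
  induction a as [|a IH]; [repeat constructor|].
  eapply ev_recS; [exact IH|]. constructor. simpl. f_equal. lia.
Qed.

Lemma eval_tri a : eval prf_tri [a] (a * (a + 1) / 2).
Proof.
  induction a as [|a IH]; [repeat constructor|].
  replace (S a * (S a + 1) / 2) with (S a + a * (a + 1) / 2).
  - eapply ev_recS; [exact IH|].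
    eapply eval_comp2; [apply eval_succ| |apply eval_add]; constructor; reflexivity.
  - replace (S a * (S a + 1)) with (a * (a + 1) + S a * 2) by lia.
    rewrite Nat.div_add by discriminate. lia.
Qed.

Lemma eval_cpair f g v a b :
  eval f v a -> eval g v b -> eval (prf_cpair f g) v (cpair a b).
Proof.
  intros Hf Hg. unfold cpair.
  eapply eval_comp2; [|exact Hg|apply eval_add].
  eapply eval_comp1; [|apply eval_tri].
  eapply eval_comp2; [exact Hf|exact Hg|apply eval_add].
Qed.

(** Predicates are identified by numbers, so each function needs a number of its own. The code
    serves only to name predicates; [prf_instance] never computes it. *)
Fixpoint prf_code (f : prf) : nat :=
  match f with
  | PZero => to_nat (0, 0)
  | PSucc => to_nat (1, 0)
  | PProj i => to_nat (2, i)
  | PComp f gs =>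
    to_nat (3, to_nat (prf_code f,
      fold_right (fun c r => S (to_nat (c, r))) 0 (map prf_code gs)))
  | PRec f g => to_nat (4, to_nat (prf_code f, prf_code g))
  | PMu f => to_nat (5, prf_code f)
  end.

Lemma prf_code_inj f : forall g, prf_code f = prf_code g -> f = g.
Proof.
  assert (Hinj : forall a b c d, to_nat (a, b) = to_nat (c, d) -> a = c /\ b = d).
  { intros a b c d H. apply to_nat_inj in H. injection H; auto. }
  induction f as [| |i|f gs IHf IHgs|f g IHf IHg|f IHf] using prf_list_ind;
    intros [| |i'|f' gs'|f' g'|f'] H; cbn [prf_code] in H;
    apply Hinj in H as [E H]; try discriminate E; clear E.
  - reflexivity.
  - reflexivity.
  - congruence.
  - apply Hinj in H as [E H]. apply IHf in E as <-. f_equal.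
    revert gs' H. induction IHgs as [|g gs Hg _ IH]; intros [|g' gs'] H;
      cbn [map fold_right] in H; try discriminate H; [reflexivity|].
    injection H as H. apply Hinj in H as [E H]. f_equal; auto.
  - apply Hinj in H as [E H]. f_equal; auto.
  - f_equal; auto.
Qed.

(** * The Datalog program of a partial recursive function *)

Definition val_pred : pred := MkPred 0 true 1 true.
Definition inp_pred : pred := MkPred 1 true 0 true.
Definition above_pred : pred := MkPred 0 false 1 true.
Definition read_pred : pred := MkPred 1 false 1 true.
Definition ans_pred : pred := MkPred 0 false 0 true.

(** Even identifiers for graphs and odd ones for searches keep the two families apart; being rigid,
    they cannot clash with the temporal predicates. *)
Definition graph_pred (f : prf) (k : nat) : pred := MkPred (2 * prf_code f) false k false.
Definition search_pred (f : prf) (k : nat) : pred := MkPred (2 * prf_code f + 1) false k false.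

Definition val_atom (x : nat) (t : tterm) : atom := MkAtom val_pred [OVar x] (Some t).
Definition graph_atom (f : prf) (l : list nat) : atom :=
  MkAtom (graph_pred f (length l)) (map OVar l) None.
Definition search_atom (f : prf) (l : list nat) : atom :=
  MkAtom (search_pred f (length l)) (map OVar l) None.
Definition above_atom (x : nat) (t : tterm) : atom := MkAtom above_pred [OVar x] (Some t).
Definition read_atom (x : nat) (t : tterm) : atom := MkAtom read_pred [OVar x] (Some t).
Definition ans_atom (t : tterm) : atom := MkAtom ans_pred [] (Some t).

Definition graph_fact (f : prf) (l : list nat) : gatom := (graph_pred f (length l), l, None).
Definition search_fact (f : prf) (l : list nat) : gatom := (search_pred f (length l), l, None).
Definition val_fact (o : nat) (t : Z) : gatom := (val_pred, [o], Some t).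
Definition above_fact (o : nat) (t : Z) : gatom := (above_pred, [o], Some t).
Definition read_fact (o : nat) (t : Z) : gatom := (read_pred, [o], Some t).
Definition ans_fact (t : Z) : gatom := (ans_pred, [], Some t).

(** These body atoms bind head variables, as range restriction demands, and force their objects to
    name numbers. *)
Definition dom (l : list nat) : list atom := map (fun x => val_atom x (TVar x)) l.

(* Variables 0-3 are scratch variables; [params k] are the parameters of a
   [k]-ary function, and intermediate values of compositions come after them. *)
Definition params (k : nat) : list nat := seq 4 k.
Definition inter (k m : nat) : list nat := seq (4 + k) m.

(* The first argument of [graph_atom f] is the value of [f]; the first argument [z]
   of [search_atom f] is a lower bound of the search: [f] is positive below [z]. *)
Fixpoint rules (f : prf) (k : nat) : list rule :=
  match f with
  | PZero =>
    [MkRule (val_atom 0 (TConst 1) :: dom (params k)) (graph_atom PZero (0 :: params k))]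
  | PSucc =>
    match k with
    | 0 => []
    | S k =>
      [MkRule (val_atom 1 (TVar 1) :: val_atom 0 (TShift 1 1) :: dom (params k))
         (graph_atom PSucc (0 :: 1 :: params k))]
    end
  | PProj i =>
    if i <? k then [MkRule (dom (params k)) (graph_atom (PProj i) (4 + i :: params k))] else []
  | PComp f gs =>
    MkRule
      (graph_atom f (0 :: inter k (length gs)) :: dom (params k) ++
       map (fun gz => graph_atom (fst gz) (snd gz :: params k))
         (combine gs (inter k (length gs))))
      (graph_atom (PComp f gs) (0 :: params k))
    :: rules f (length gs) ++ flat_map (fun g => rules g k) gs
  | PRec f g =>
    match k with
    | 0 => []
    | S k =>
      MkRule [val_atom 1 (TConst 1); graph_atom f (0 :: params k)]
        (graph_atom (PRec f g) (0 :: 1 :: params k))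
      :: MkRule [val_atom 2 (TVar 2); val_atom 1 (TShift 2 1);
                 graph_atom (PRec f g) (3 :: 2 :: params k);
                 graph_atom g (0 :: 2 :: 3 :: params k)]
           (graph_atom (PRec f g) (0 :: 1 :: params k))
      :: rules f k ++ rules g (S (S k))
    end
  | PMu f =>
    MkRule (val_atom 0 (TConst 1) :: dom (params k)) (search_atom f (0 :: params k))
    :: MkRule [search_atom f (0 :: params k); graph_atom f (1 :: 0 :: params k);
               val_atom 2 (TVar 2); val_atom 1 (TShift 2 1);
               val_atom 0 (TVar 0); val_atom 3 (TShift 0 1)]
         (search_atom f (3 :: params k))
    :: MkRule [search_atom f (0 :: params k); graph_atom f (1 :: 0 :: params k);
               val_atom 1 (TConst 1)]
         (graph_atom (PMu f) (0 :: params k))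
    :: rules f (S k)
  end.

(* The first four rules derive every answer at a time [>= 0] as soon as some object
   has two values.
   With the input fact at time [-n], [read_atom x t] says that [x] has value [n + t],
   so that [read_atom x 0] singles out the objects naming [n]. *)
Definition driver_rules (p : prf) : list rule :=
  [MkRule [val_atom 0 (TVar 0)] (above_atom 0 (TShift 0 1));
   MkRule [above_atom 0 (TVar 0)] (above_atom 0 (TShift 0 1));
   MkRule [above_atom 0 (TVar 0); val_atom 0 (TVar 0)] (ans_atom (TConst 0));
   MkRule [ans_atom (TVar 0)] (ans_atom (TShift 0 1));
   MkRule [MkAtom inp_pred [] (Some (TVar 1)); val_atom 0 (TConst 1)] (read_atom 0 (TVar 1));
   MkRule [read_atom 0 (TVar 0); val_atom 0 (TVar 1); val_atom 1 (TShift 1 1)]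
     (read_atom 1 (TShift 0 1));
   MkRule [read_atom 1 (TConst 0); graph_atom p [0; 1]; val_atom 0 (TConst 2)]
     (ans_atom (TConst 0))].

Definition compile (p : prf) : program := driver_rules p ++ rules p 1.

Definition compiled_query (p : prf) : query := MkQuery ans_pred (compile p).

(** * Well-formedness of the compiled program *)

Lemma flat_map_OVar l :
  flat_map (fun t => match t with OVar x => [x] | OConst _ => [] end) (map OVar l) = l.
Proof. induction l; simpl; congruence. Qed.

Lemma ovars_of_graph f l : ovars_of (graph_atom f l) = l.
Proof. apply flat_map_OVar. Qed.

Lemma ovars_of_search f l : ovars_of (search_atom f l) = l.
Proof. apply flat_map_OVar. Qed.

Lemma ovars_of_dom l : flat_map ovars_of (dom l) = l.
Proof. induction l; simpl; congruence. Qed.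

Lemma wf_graph_atom f l : wf_atom (graph_atom f l).
Proof. split; [apply length_map|reflexivity]. Qed.

Lemma wf_search_atom f l : wf_atom (search_atom f l).
Proof. split; [apply length_map|reflexivity]. Qed.

Lemma wf_val_atom x t : wf_atom (val_atom x t).
Proof. split; reflexivity. Qed.

Lemma wf_dom l : Forall wf_atom (dom l).
Proof. apply Forall_map, Forall_forall. intros; apply wf_val_atom. Qed.

Lemma wf_ruleI body head :
  wf_atom head -> p_edb (a_pred head) = false -> Forall wf_atom body ->
  incl (ovars_of head) (flat_map ovars_of body) ->
  incl (tvars_of head) (flat_map tvars_of body) ->
  wf_rule (MkRule body head).
Proof.
  intros Hh He Hb Ho Ht. unfold wf_rule; simpl.
  rewrite Forall_forall in Hb.
  repeat split; try apply Hh; try (apply Hb; assumption); auto.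
  - intros x Hx. apply Ho, in_flat_map in Hx. exact Hx.
  - intros x Hx. apply Ht, in_flat_map in Hx. exact Hx.
Qed.

Create HintDb wf.
#[local] Hint Resolve wf_graph_atom wf_search_atom wf_val_atom wf_dom : wf.
#[local] Hint Constructors Forall : wf.

Ltac solve_wf_rule :=
  apply wf_ruleI; [auto with wf|reflexivity|auto 8 with wf|..];
  cbn [flat_map]; rewrite ?ovars_of_graph, ?ovars_of_search;
  [intros x; rewrite ?ovars_of_dom; simpl; repeat (rewrite in_app_iff; simpl); tauto
  |intros x []].

Lemma wf_rules f : forall k, Forall wf_rule (rules f k).
Proof.
  induction f as [| |i|f gs IHf IHgs|f g IHf IHg|f IHf] using prf_list_ind;
    intros k; cbn [rules].
  - constructor; [solve_wf_rule|constructor].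
  - destruct k as [|k]; constructor; [solve_wf_rule|constructor].
  - destruct (Nat.ltb_spec i k) as [Hi|_]; constructor; [|constructor].
    apply wf_ruleI; auto with wf.
    + rewrite ovars_of_graph, ovars_of_dom. intros x [<-|Hx]; [|exact Hx].
      apply in_seq. lia.
    + intros x [].
  - constructor; [apply wf_ruleI|].
    + auto with wf.
    + reflexivity.
    + constructor; [auto with wf|]. apply Forall_app; split; [auto with wf|].
      apply Forall_map, Forall_forall. auto with wf.
    + cbn [flat_map]. rewrite flat_map_app, !ovars_of_graph, ovars_of_dom.
      intros x; simpl; rewrite !in_app_iff; tauto.
    + intros x [].
    + apply Forall_app; split; [apply IHf|]. apply Forall_flat_map.
      eapply Forall_impl; [|exact IHgs]. auto.
  - destruct k as [|k]; [constructor|].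
    do 2 (constructor; [solve_wf_rule|]). apply Forall_app; auto.
  - do 3 (constructor; [solve_wf_rule|]). auto.
Qed.

Lemma wf_compile p : wf_program (compile p).
Proof.
  assert (H : Forall wf_rule (compile p)); [|rewrite Forall_forall in H; exact H].
  apply Forall_app; split; [|apply wf_rules].
  repeat apply Forall_cons; [..|apply Forall_nil];
    (apply wf_ruleI;
     [split; reflexivity|reflexivity
     |repeat constructor
     |intros x; simpl; tauto|intros x; simpl; tauto]).
Qed.

(** * Soundness and completeness of the compilation *)

Lemma length_inter k m : length (inter k m) = m.
Proof. apply length_seq. Qed.

Lemma inst_graph_atom s f l :
  inst_atom s (graph_atom f l) = graph_fact f (map (s_obj s) l).
Proof.
  unfold inst_atom, graph_fact; simpl. now rewrite map_map, length_map.
Qed.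

Lemma inst_search_atom s f l :
  inst_atom s (search_atom f l) = search_fact f (map (s_obj s) l).
Proof.
  unfold inst_atom, search_fact; simpl. now rewrite map_map, length_map.
Qed.

Definition rule_holds (I : interp) (r : rule) : Prop :=
  forall s, Forall (fun b => I (inst_atom s b)) (r_body r) -> I (inst_atom s (r_head r)).

Lemma is_model_Forall P I : is_model P I <-> Forall (rule_holds I) P.
Proof.
  rewrite Forall_forall. unfold is_model, rule_holds. split.
  - intros H r Hr s Hb. rewrite Forall_forall in Hb. auto.
  - intros H r s Hr Hb. apply H; [exact Hr|]. now apply Forall_forall.
Qed.

Lemma is_model_app P P' I : is_model (P ++ P') I <-> is_model P I /\ is_model P' I.
Proof. rewrite !is_model_Forall. apply Forall_app. Qed.

(** Facts are ground, so all substitutions yield the same instance; this turns atoms of a dataset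
    into ground atoms. *)
Definition holds (X : dataset) (g : gatom) : Prop :=
  exists a, In a X /\ forall s, inst_atom s a = g.

Lemma fact_holds (X : dataset) a s : is_dataset X -> In a X -> holds X (inst_atom s a).
Proof.
  intros HX Ha. exists a. split; [exact Ha|]. intros s'.
  destruct (HX a Ha) as [(_ & Ho & Ht) _]. unfold inst_atom. f_equal; [f_equal|].
  - apply map_ext_in. intros t Hin. destruct (Ho t Hin) as [o ->]. reflexivity.
  - destruct (a_time a) as [[]|]; try contradiction; reflexivity.
Qed.

Lemma holds_edb (X : dataset) p l t : is_dataset X -> holds X (p, l, t) -> p_edb p = true.
Proof.
  intros HX (a & Ha & E). specialize (E (MkSubst (fun _ => 0) (fun _ => 0%Z))).
  injection E as <- _ _. apply HX, Ha.
Qed.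

Lemma is_model_facts (X : dataset) I :
  is_dataset X -> (is_model (map fact_rule X) I <-> forall g, holds X g -> I g).
Proof.
  intros HX. split.
  - intros H g (a & Ha & E). pose (s := MkSubst (fun _ => 0) (fun _ => 0%Z)).
    rewrite <- (E s). apply (H (fact_rule a) s); [now apply in_map|intros b []].
  - intros H r s Hr _. apply in_map_iff in Hr as (a & <- & Ha).
    apply H, fact_holds; assumption.
Qed.

(** * Soundness: the intended model of an unambiguous dataset *)

Section Soundness.

Variable X : dataset.
Hypothesis X_edb : is_dataset X.
Hypothesis val_pos : forall o t, holds X (val_fact o t) -> (0 < t)%Z.
Hypothesis val_fun :
  forall o t t', holds X (val_fact o t) -> holds X (val_fact o t') -> t = t'.

(** The offset puts the value 0 at time 1, the first time open to an update after time 0. *)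
Definition names (o v : nat) : Prop := holds X (val_fact o (Z.of_nat v + 1)).

(** No clause yields [ans_pred], so this model refutes every answer. In the [read] clause, time
    minus value is the time of an input fact. *)
Inductive intended : interp :=
| intended_edb p l t : p_edb p = true -> holds X (p, l, t) -> intended (p, l, t)
| intended_graph f l y vs :
    Forall2 names l (y :: vs) -> eval f vs y -> intended (graph_fact f l)
| intended_search f l y vs :
    Forall2 names l (y :: vs) ->
    (forall z, z < y -> exists m, eval f (z :: vs) (S m)) -> intended (search_fact f l)
| intended_above o t0 t :
  holds X (val_fact o t0) -> (t0 < t)%Z -> intended (above_fact o t)
| intended_read o v t :
    names o v -> holds X (inp_pred, [], Some (t - Z.of_nat v)%Z) -> intended (read_fact o t).

Lemma names_fun o v v' : names o v -> names o v' -> v = v'.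
Proof. intros H H'. pose proof (val_fun _ _ _ H H'). lia. Qed.

Lemma names_list_fun l vs vs' : Forall2 names l vs -> Forall2 names l vs' -> vs = vs'.
Proof.
  intros H; revert vs'; induction H; intros vs' H'; inversion H'; subst; f_equal; auto.
  eapply names_fun; eassumption.
Qed.

Lemma val_names o t : holds X (val_fact o t) -> exists v, names o v /\ t = (Z.of_nat v + 1)%Z.
Proof.
  intros H. pose proof (val_pos _ _ H). exists (Z.to_nat (t - 1)).
  unfold names. rewrite Z2Nat.id by lia. split; [|lia].
  now replace (t - 1 + 1)%Z with t by lia.
Qed.

Lemma intended_val_inv o t :
  intended (val_fact o t) -> exists v, names o v /\ t = (Z.of_nat v + 1)%Z.
Proof. intros H; inversion H; subst. now apply val_names. Qed.

(** Parity of the identifier excludes the search clause, and injectivity of [prf_code] recovers the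
    function. *)
Lemma intended_graph_inv f l :
  intended (graph_fact f l) -> exists y vs, Forall2 names l (y :: vs) /\ eval f vs y.
Proof.
  intros H; inversion H as [p l0 t E E'|f0 l0 y vs Hl Hf E|f0 l0 y vs Hl Hf E| | ]; subst.
  - discriminate E.
  - replace f with f0 by (apply prf_code_inj; lia). eauto.
  - lia.
Qed.

Lemma intended_search_inv f l :
  intended (search_fact f l) -> exists y vs, Forall2 names l (y :: vs) /\
    forall z, z < y -> exists m, eval f (z :: vs) (S m).
Proof.
  intros H; inversion H as [p l0 t E E'|f0 l0 y vs Hl Hf E|f0 l0 y vs Hl Hf E| | ]; subst.
  - discriminate E.
  - lia.
  - replace f with f0 by (apply prf_code_inj; lia). eauto.
Qed.

Lemma intended_dom s l :
  Forall (fun b => intended (inst_atom s b)) (dom l) ->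
  exists vs, Forall2 names (map (s_obj s) l) vs.
Proof.
  unfold dom. rewrite Forall_map. induction 1 as [|x l' Hx _ [vs IH]]; simpl; [eauto|].
  apply intended_val_inv in Hx as (v & Hv & _). eauto.
Qed.

(** Unambiguous naming identifies parameters and intermediate values across separate body atoms,
    which then assemble into one evaluation. *)
Lemma intended_args s gs zs l vs ws :
  length zs = length gs ->
  Forall (fun b => intended (inst_atom s b))
    (map (fun gz => graph_atom (fst gz) (snd gz :: l)) (combine gs zs)) ->
  Forall2 names (map (s_obj s) l) vs -> Forall2 names (map (s_obj s) zs) ws ->
  evals gs vs ws.
Proof.
  intros Hlen H Hvs. revert zs ws Hlen H.
  induction gs as [|g gs IH]; intros [|z zs] ws Hlen H Hws; try discriminate Hlen;
    inversion Hws as [|o w ? ws' Hw Hws']; subst; constructor.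
  - cbn in H. apply Forall_cons_iff in H as [H _]. rewrite inst_graph_atom in H.
    apply intended_graph_inv in H as (y & vs' & Hy & Hg).
    inversion Hy as [|? ? ? ? Hy' Hvs']; subst.
    rewrite (names_list_fun _ _ _ Hvs Hvs'), (names_fun _ _ _ Hw Hy'). exact Hg.
  - cbn in H. apply Forall_cons_iff in H as [_ H]. eauto.
Qed.

Lemma Forall2_nth_error {A B} (R : A -> B -> Prop) l l' i a :
  Forall2 R l l' -> nth_error l i = Some a -> exists b, nth_error l' i = Some b /\ R a b.
Proof.
  intros H; revert i; induction H; intros [|i] E; try discriminate E; simpl in *; auto.
  injection E as <-. eauto.
Qed.

Ltac unpack :=
  repeat match goal with
  | H : _ /\ _ |- _ => destruct H
  | H : exists _, _ |- _ => destruct H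
  | H : True |- _ => clear H
  | H : Forall _ (_ :: _) |- _ => apply Forall_cons_iff in H
  | H : Forall _ [] |- _ => clear H
  | H : Forall _ (_ ++ _) |- _ => apply Forall_app in H
  | H : Forall _ (dom _) |- _ => apply intended_dom in H
  | H : intended (inst_atom _ (graph_atom _ _)) |- _ =>
    rewrite inst_graph_atom in H; apply intended_graph_inv in H
  | H : intended (inst_atom _ (search_atom _ _)) |- _ =>
    rewrite inst_search_atom in H; apply intended_search_inv in H
  | H : intended (inst_atom _ (val_atom _ _)) |- _ =>
    apply intended_val_inv in H; simpl in H
  | H : Forall2 names (_ :: _) _ |- _ => inversion H; clear H; subst
  end.

Ltac unify_names :=
  repeat match goal with
  | H : names ?o ?v, H' : names ?o ?v' |- _ =>
    pose proof (names_fun _ _ _ H H'); clear H'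
  | H : Forall2 names ?o ?v, H' : Forall2 names ?o ?v' |- _ =>
    pose proof (names_list_fun _ _ _ H H'); clear H'
  end; subst.

(** The shapes in which rules speak of values: time 1 means zero, time 2 means one, and a shift by
    one means successor. *)
Ltac solve_values :=
  repeat match goal with
  | H : 1%Z = (Z.of_nat ?v + 1)%Z |- _ => assert (v = 0) by lia; clear H
  | H : 2%Z = (Z.of_nat ?v + 1)%Z |- _ => assert (v = 1) by lia; clear H
  | H : (s_time ?s ?i + 1)%Z = (Z.of_nat ?w + 1)%Z,
    H' : s_time ?s ?i = (Z.of_nat ?v + 1)%Z |- _ => assert (w = S v) by lia; clear H
  end.

Ltac analyze_body :=
  intros s H; cbn [r_body r_head] in *; unpack; simpl in *; unpack;
  solve_values; subst; unify_names;
  rewrite ?inst_graph_atom, ?inst_search_atom.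

(** Each rule is a defining equation read from body to head: names determine values, so an object
    shared by body atoms carries one value throughout. *)
Lemma rules_sound f : forall k, Forall (rule_holds intended) (rules f k).
Proof.
  induction f as [| |i|f gs IHf IHgs|f g IHf IHg|f IHf] using prf_list_ind;
    intros k; cbn [rules].
  - constructor; [|constructor]. analyze_body.
    eapply intended_graph; [|constructor]. simpl; eauto.
  - destruct k as [|k]; constructor; [|constructor]. analyze_body.
    eapply intended_graph; [|constructor]. simpl; eauto.
  - destruct (Nat.ltb_spec i k) as [Hi|_]; constructor; [|constructor].
    intros s H. cbn [r_body r_head] in *. unpack.
    destruct (Forall2_nth_error _ _ _ i (s_obj s (4 + i)) H) as (y & Hy & Hn).
    { rewrite nth_error_map. unfold params. rewrite nth_error_seq.
      apply Nat.ltb_lt in Hi. now rewrite Hi. }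
    rewrite inst_graph_atom. eapply intended_graph; [|constructor; eassumption].
    constructor; eassumption.
  - constructor.
    + analyze_body. eapply intended_graph; [simpl; eauto|].
      eapply ev_comp; [|eassumption].
      eapply intended_args; try eassumption. apply length_inter.
    + apply Forall_app; split; [apply IHf|]. apply Forall_flat_map.
      eapply Forall_impl; [|exact IHgs]. auto.
  - destruct k as [|k]; [constructor|].
    constructor; [|constructor]; [..|apply Forall_app; auto].
    + analyze_body. eapply intended_graph; [simpl; eauto|]. now constructor.
    + analyze_body. eapply intended_graph; [simpl; eauto|]. eapply ev_recS; eassumption.
  - constructor; [|constructor; [|constructor; [|auto]]].
    + analyze_body. eapply intended_search; [simpl; eauto|]. lia.
    + analyze_body. eapply intended_search; [simpl; eauto|].
      (* The only new [z] is the previous bound, at which the body exhibits a positive value. *)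
      intros z Hz. apply Nat.lt_succ_r, Nat.lt_eq_cases in Hz as [Hz| ->]; eauto.
    + analyze_body. eapply intended_graph; [simpl; eauto|]. constructor; assumption.
Qed.

Variable p : prf.
(** Applied to the history with an update, this concerns a single [n]; applied to an update alone it
    is vacuous, as no input fact then lies at a time up to 0. *)
Hypothesis not_one :
  forall n, holds X (inp_pred, [], Some (- Z.of_nat n)%Z) -> ~ eval p [n] 1.

Lemma intended_edb_inv q l t : p_edb q = true -> intended (q, l, t) -> holds X (q, l, t).
Proof. intros E H; inversion H; subst; assumption || discriminate E. Qed.

Lemma intended_above_inv o t :
  intended (above_fact o t) -> exists t0, holds X (val_fact o t0) /\ (t0 < t)%Z.
Proof. intros H; inversion H; subst; [discriminate|eauto]. Qed.

Lemma intended_read_inv o t :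
  intended (read_fact o t) ->
  exists v, names o v /\ holds X (inp_pred, [], Some (t - Z.of_nat v)%Z).
Proof. intros H; inversion H; subst; [discriminate|eauto]. Qed.

Lemma intended_ans t : ~ intended (ans_fact t).
Proof. intros H; inversion H; discriminate. Qed.

Lemma driver_rules_sound : Forall (rule_holds intended) (driver_rules p).
Proof.
  repeat apply Forall_cons; [..|apply Forall_nil]; intros s H; cbn [r_body r_head] in *;
    repeat rewrite Forall_cons_iff in H.
  - destruct H as [H _]. apply intended_edb_inv in H; [|reflexivity].
    apply intended_above with (1 := H). simpl. lia.
  - destruct H as [H _]. apply intended_above_inv in H as (t0 & H & Hlt).
    apply intended_above with (1 := H). simpl in *. lia.
  (* An earlier value of the same object contradicts [val_fun]. *)
  - destruct H as (H & H' & _). apply intended_above_inv in H as (t0 & H & Hlt).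
    apply intended_edb_inv in H'; [|reflexivity].
    pose proof (val_fun _ _ _ H H'). simpl in *. lia.
  - destruct H as [H _]. now apply intended_ans in H.
  - destruct H as (H & H' & _). apply intended_edb_inv in H; [|reflexivity].
    apply intended_val_inv in H' as (v & Hv & E). simpl in E.
    eapply intended_read; [exact Hv|]. replace v with 0 by lia.
    simpl. now rewrite Z.sub_0_r.
  (* Value and time advance together, so their difference remains the time of the input fact. *)
  - destruct H as (H & H1 & H2 & _). apply intended_read_inv in H as (v & Hv & H).
    apply intended_val_inv in H1 as (v1 & Hv1 & E1).
    apply intended_val_inv in H2 as (v2 & Hv2 & E2). simpl in *.
    rewrite (names_fun _ _ _ Hv1 Hv) in *.
    eapply intended_read; [exact Hv2|]. simpl.
    now replace (s_time s 0 + 1 - Z.of_nat v2)%Z with (s_time s 0 - Z.of_nat v)%Z by lia.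
  (* Reading [v] at time 0 puts an input fact at [- v], so [not_one] applies; time 2 makes the value
     of the graph atom 1. *)
  - destruct H as (H & H1 & H2 & _). apply intended_read_inv in H as (v & Hv & H).
    simpl in H. apply not_one in H.
    rewrite inst_graph_atom in H1. apply intended_graph_inv in H1 as (y & vs & Hn & He).
    apply intended_val_inv in H2 as (y' & Hy & E).
    inversion Hn as [|? ? ? ? Hy' Hx]; subst. inversion Hx as [|? ? ? ? Hv' Hnil]; subst.
    inversion Hnil; subst. simpl in *.
    rewrite (names_fun _ _ _ Hy' Hy), (names_fun _ _ _ Hv' Hv) in He.
    exfalso. apply H. now replace 1 with y' by lia.
Qed.

Lemma not_entails_ans t : ~ entails (prog_with (compile p) X) (ans_fact t).
Proof.
  intros H. apply (intended_ans t), H.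
  apply is_model_app; split; [apply is_model_app; split|].
  - apply is_model_Forall, driver_rules_sound.
  - apply is_model_Forall, rules_sound.
  - apply is_model_facts; [exact X_edb|]. intros [[q l] t'] Hg.
    apply intended_edb; [|exact Hg]. eapply holds_edb; eassumption.
Qed.

End Soundness.

(** * Completeness: derivations from sufficiently many named numbers *)

Definition assign (a b c d : nat) (vs ws : list nat) : subst :=
  let l := a :: b :: c :: d :: vs ++ ws in
  MkSubst (fun i => nth i l 0) (fun i => Z.add (Z.of_nat (nth i l 0)) 1).

Lemma map_nth_seq (l1 l2 l3 : list nat) :
  map (fun i => nth i (l1 ++ l2 ++ l3) 0) (seq (length l1) (length l2)) = l2.
Proof.
  revert l1; induction l2 as [|x l2 IH]; intros l1; simpl; [reflexivity|]. f_equal.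
  - rewrite app_nth2, Nat.sub_diag by lia. reflexivity.
  - specialize (IH (l1 ++ [x])). rewrite length_app, Nat.add_1_r, <- app_assoc in IH.
    exact IH.
Qed.

Lemma map_params a b c d vs ws :
  map (s_obj (assign a b c d vs ws)) (params (length vs)) = vs.
Proof. exact (map_nth_seq [a; b; c; d] vs ws). Qed.

Lemma map_inter a b c d vs ws :
  map (s_obj (assign a b c d vs ws)) (inter (length vs) (length ws)) = ws.
Proof.
  pose proof (map_nth_seq (a :: b :: c :: d :: vs) ws []) as H.
  rewrite app_nil_r in H. exact H.
Qed.

(** Here object [i] names [i], which is why [assign] sends a time variable one past the object
    variable of the same index. *)
Definition numbers (N : nat) (I : interp) : Prop :=
  forall i, i <= N -> I (val_fact i (Z.of_nat i + 1)).

(** [N] is chosen before [I]: a single finite update has to serve all models. *)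
Definition derivable (f : prf) : Prop :=
  forall vs y, eval f vs y -> exists N, forall I, numbers N I ->
    Forall (rule_holds I) (rules f (length vs)) -> I (graph_fact f (y :: vs)).

Lemma numbers_le N N' I : N <= N' -> numbers N' I -> numbers N I.
Proof. intros H H' i Hi. apply H'. lia. Qed.

Lemma numbers_succ N I i : numbers N I -> i < N -> I (val_fact (S i) (Z.of_nat i + 1 + 1)).
Proof. intros H Hi. specialize (H (S i) Hi). now rewrite Nat2Z.inj_succ, <- Z.add_1_r in H. Qed.

Lemma numbers_dom N I a b c d vs ws :
  numbers N I -> list_max vs <= N ->
  Forall (fun x => I (inst_atom (assign a b c d vs ws) x)) (dom (params (length vs))).
Proof.
  intros HN H. apply list_max_le in H.
  unfold dom. apply Forall_map.
  change (Forall (fun x => (fun v => I (val_fact v (Z.of_nat v + 1)))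
    (s_obj (assign a b c d vs ws) x)) (params (length vs))).
  apply Forall_map. rewrite map_params.
  eapply Forall_impl; [|exact H]. exact HN.
Qed.

Lemma derivable_list gs vs ws :
  Forall derivable gs -> evals gs vs ws ->
  exists N, forall I, numbers N I ->
    Forall (rule_holds I) (flat_map (fun g => rules g (length vs)) gs) ->
    Forall2 (fun g w => I (graph_fact g (w :: vs))) gs ws.
Proof.
  intros H Hs. apply evals_Forall2 in Hs. induction Hs as [|g w gs ws Hg _ IH].
  - exists 0. constructor.
  - apply Forall_cons_iff in H as [H1 H2].
    destruct (H1 _ _ Hg) as [N1 HN1], (IH H2) as [N2 HN2].
    exists (max N1 N2). intros I HI Hr. apply Forall_app in Hr as [Hr1 Hr2]. constructor.
    + apply HN1; [|exact Hr1]. eapply numbers_le; [|exact HI]. lia.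
    + apply HN2; [|exact Hr2]. eapply numbers_le; [|exact HI]. lia.
Qed.

Lemma args_hold I s gs l zs vs ws :
  map (s_obj s) l = vs -> map (s_obj s) zs = ws ->
  Forall2 (fun g w => I (graph_fact g (w :: vs))) gs ws ->
  Forall (fun b => I (inst_atom s b))
    (map (fun gz => graph_atom (fst gz) (snd gz :: l)) (combine gs zs)).
Proof.
  intros <- Hz H. revert zs Hz. induction H as [|g w gs ws Hg _ IH]; intros [|z zs] Hz;
    try discriminate Hz; constructor.
  - injection Hz as <- _. rewrite inst_graph_atom. exact Hg.
  - injection Hz as _ Hz. apply IH, Hz.
Qed.

Ltac apply_rule Hr s :=
  let H := fresh in
  pose proof (Hr s) as H; cbn [r_body r_head] in H;
  rewrite ?inst_graph_atom, ?inst_search_atom in H; cbn [map] in H;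
  rewrite ?map_params in H; apply H; clear H;
  repeat (apply Forall_cons || apply Forall_nil);
  rewrite ?inst_graph_atom, ?inst_search_atom; cbn [map];
  rewrite ?map_params; cbn [assign s_obj nth].

Lemma rules_complete f : derivable f.
Proof.
  induction f as [| |i|f gs IHf IHgs|f g IHf IHg|f IHf] using prf_list_ind;
    intros vs y H.
  - inversion H; subst. exists (list_max vs). intros I HI Hr.
    cbn [rules] in Hr. apply Forall_cons_iff in Hr as [Hr _].
    apply_rule Hr (assign 0 0 0 0 vs []).
    + apply (HI 0). lia.
    + eapply numbers_dom; [exact HI|reflexivity].
  (* The bound must also reach the result [S n], which exceeds the first argument. *)
  - inversion H as [|n v| | | | |]; subst. exists (max (list_max v) (S n)).
    intros I HI Hr. cbn [rules length] in Hr. apply Forall_cons_iff in Hr as [Hr _].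
    apply_rule Hr (assign (S n) n 0 0 v []).
    + apply (HI n). lia.
    + apply (numbers_succ _ _ n HI). lia.
    + eapply numbers_dom; [exact HI|lia].
  - inversion H as [| |? ? ? Hi| | | |]; subst. exists (list_max vs).
    intros I HI Hr. cbn [rules] in Hr.
    assert (Hlt : i < length vs) by (apply nth_error_Some; congruence).
    pose proof Hlt as Hltb. apply Nat.ltb_lt in Hltb. rewrite Hltb in Hr.
    apply Forall_cons_iff in Hr as [Hr _].
    specialize (Hr (assign 0 0 0 0 vs [])). cbn [r_body r_head] in Hr.
    rewrite inst_graph_atom in Hr. cbn [map] in Hr. rewrite map_params in Hr.
    replace (s_obj (assign 0 0 0 0 vs []) (4 + i)) with y in Hr.
    + apply Hr. eapply numbers_dom; [exact HI|reflexivity].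
    + simpl. rewrite app_nil_r. symmetry. apply nth_error_nth, Hi.
  - inversion H as [| | |? ? ? ws ? Hs Hf| | |]; subst.
    destruct (IHf _ _ Hf) as [N1 HN1], (derivable_list _ _ _ IHgs Hs) as [N2 HN2].
    assert (Hlen : length gs = length ws).
    { apply evals_Forall2 in Hs. eapply Forall2_length, Hs. }
    exists (list_max vs + N1 + N2). intros I HI Hr. cbn [rules] in Hr.
    apply Forall_cons_iff in Hr as [Hr Hr']. apply Forall_app in Hr' as [Hr1 Hr2].
    rewrite Hlen in Hr, Hr1.
    specialize (Hr (assign y 0 0 0 vs ws)). cbn [r_body r_head] in Hr.
    rewrite !inst_graph_atom in Hr. cbn [map] in Hr. rewrite map_params in Hr.
    apply Hr. constructor; [|apply Forall_app; split].
    + rewrite inst_graph_atom. cbn [map]. rewrite map_inter. cbn [assign s_obj nth].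
      apply HN1; [|exact Hr1]. eapply numbers_le; [|exact HI]. lia.
    + eapply numbers_dom; [exact HI|lia].
    + eapply args_hold; [apply map_params|apply map_inter|].
      apply HN2; [|exact Hr2]. eapply numbers_le; [|exact HI]. lia.
  - destruct vs as [|n v]; [inversion H|].
    (* Inner induction on the recursion argument: the graph fact at [n] feeds the rule deriving the
       one at [S n]. *)
    revert y H. induction n as [|n IHn]; intros y H.
    + inversion H as [| | | |? ? ? ? Hf| |]; subst.
      destruct (IHf _ _ Hf) as [N HN]. exists N. intros I HI Hr.
      cbn [rules length] in Hr. apply Forall_cons_iff in Hr as [Hr Hr'].
      apply Forall_cons_iff in Hr' as [_ Hr']. apply Forall_app in Hr' as [Hr1 _].
      apply_rule Hr (assign y 0 0 0 v []).
      * apply (HI 0). lia.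
      * apply HN; assumption.
    + inversion H as [| | | | |? ? ? ? r ? Hf Hg|]; subst.
      destruct (IHn _ Hf) as [N1 HN1], (IHg _ _ Hg) as [N2 HN2].
      exists (S n + N1 + N2). intros I HI Hr. pose proof Hr as Hrules.
      cbn [rules length] in Hr. apply Forall_cons_iff in Hr as [_ Hr'].
      apply Forall_cons_iff in Hr' as [Hr Hr']. apply Forall_app in Hr' as [_ Hr2].
      apply_rule Hr (assign y (S n) n r v []).
      * apply (HI n). lia.
      * apply (numbers_succ _ _ n HI). lia.
      * apply HN1; [|exact Hrules]. eapply numbers_le; [|exact HI]. lia.
      * apply HN2; [|exact Hr2]. eapply numbers_le; [|exact HI]. lia.
  - inversion H as [| | | | | |? ? ? H0 Hlt]; subst.
    (* The search climbs one value at a time up to [y], each step using the positive value [S m] of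
       [f] at [j]. *)
    assert (Hsearch : forall j, j <= y -> exists N, forall I, numbers N I ->
      Forall (rule_holds I) (rules (PMu f) (length vs)) -> I (search_fact f (j :: vs))).
    { induction j as [|j IHj]; intros Hj.
      - exists (list_max vs). intros I HI Hr.
        cbn [rules] in Hr. apply Forall_cons_iff in Hr as [Hr _].
        apply_rule Hr (assign 0 0 0 0 vs []).
        + apply (HI 0). lia.
        + eapply numbers_dom; [exact HI|reflexivity].
      - destruct (Hlt j Hj) as [m Hm], IHj as [N1 HN1]; [lia|].
        (* [S j] and [S m] must be named for the two successor tests in the rule. *)
        destruct (IHf _ _ Hm) as [N2 HN2]. exists (S j + S m + N1 + N2).
        intros I HI Hr. specialize (HN1 I).
        assert (I (search_fact f (j :: vs))).
        { apply HN1; [|exact Hr]. eapply numbers_le; [|exact HI]. lia. }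
        cbn [rules] in Hr. apply Forall_cons_iff in Hr as [_ Hr'].
        apply Forall_cons_iff in Hr' as [Hr Hr'].
        apply Forall_cons_iff in Hr' as [_ Hr2].
        apply_rule Hr (assign j (S m) m (S j) vs []).
        + assumption.
        + apply HN2; [|exact Hr2]. eapply numbers_le; [|exact HI]. lia.
        + apply (HI m). lia.
        + apply (numbers_succ _ _ m HI). lia.
        + apply (HI j). lia.
        + apply (numbers_succ _ _ j HI). lia. }
    destruct (Hsearch y) as [N1 HN1]; [lia|]. destruct (IHf _ _ H0) as [N2 HN2].
    exists (N1 + N2). intros I HI Hr.
    assert (I (search_fact f (y :: vs))).
    { apply HN1; [|exact Hr]. eapply numbers_le; [|exact HI]. lia. }
    cbn [rules] in Hr. apply Forall_cons_iff in Hr as [_ Hr'].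
    apply Forall_cons_iff in Hr' as [_ Hr']. apply Forall_cons_iff in Hr' as [Hr Hr2].
    apply_rule Hr (assign y 0 0 0 vs []).
    + assumption.
    + apply HN2; [|exact Hr2]. eapply numbers_le; [|exact HI]. lia.
    + apply (HI 0). lia.
Qed.

(** * Entailed answers of the compiled query *)

Lemma is_model_compile (p : prf) (X : dataset) I :
  is_dataset X -> is_model (prog_with (compile p) X) I ->
  Forall (rule_holds I) (driver_rules p) /\ Forall (rule_holds I) (rules p 1) /\
  forall g, holds X g -> I g.
Proof.
  intros HX H. apply is_model_app in H as [H HI]. apply is_model_app in H as [Hd Hr].
  rewrite is_model_Forall in Hd, Hr. repeat split; auto. now apply is_model_facts.
Qed.

Lemma ans_from_zero p I t :
  Forall (rule_holds I) (driver_rules p) -> I (ans_fact 0) -> (0 <= t)%Z -> I (ans_fact t).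
Proof.
  intros Hd H0. revert t. apply natlike_ind; [exact H0|]. intros t _ Ht.
  do 3 apply Forall_inv_tail in Hd. apply Forall_inv in Hd.
  apply (Hd (MkSubst (fun _ => 0) (fun _ => t))). repeat constructor. exact Ht.
Qed.

(** [above_pred] spreads from the earlier value to all later times, meets the second value and
    triggers the answer at 0, whence at [tau]. *)
Lemma entails_ans_ambiguous p X o t t' tau :
  is_dataset X -> holds X (val_fact o t) -> holds X (val_fact o t') -> (t < t')%Z ->
  (0 <= tau)%Z -> entails (prog_with (compile p) X) (ans_fact tau).
Proof.
  intros HX Ht Ht' Hlt Htau I HI. apply is_model_compile in HI as (Hd & _ & Hf); [|exact HX].
  apply (ans_from_zero p); [exact Hd| |exact Htau].
  inversion Hd as [|? ? R1 Hd1]; subst. inversion Hd1 as [|? ? R2 Hd2]; subst.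
  inversion Hd2 as [|? ? R3 _]; subst.
  assert (Habove : forall k, (0 <= k)%Z -> I (above_fact o (t + 1 + k))).
  { apply natlike_ind.
    - rewrite Z.add_0_r. apply (R1 (MkSubst (fun _ => o) (fun _ => t))).
      repeat constructor. apply Hf, Ht.
    - intros k _ Hk. rewrite Z.add_succ_r, <- Z.add_1_r.
      apply (R2 (MkSubst (fun _ => o) (fun _ => (t + 1 + k)%Z))).
      repeat constructor. exact Hk. }
  apply (R3 (MkSubst (fun _ => o) (fun _ => t'))). repeat constructor.
  - specialize (Habove (t' - t - 1)%Z).
    replace (t + 1 + (t' - t - 1))%Z with t' in Habove by lia. apply Habove. lia.
  - apply Hf, Ht'.
Qed.

(** The input is stored as a time because objects have no value until an update names them. *)
Definition input_data (n : nat) : dataset :=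
  [MkAtom inp_pred [] (Some (TConst (- Z.of_nat n)))].

Definition number_data (N : nat) : dataset :=
  map (fun i => MkAtom val_pred [OConst i] (Some (TConst (Z.of_nat i + 1)))) (seq 0 (S N)).

Lemma update_number_data N : is_update 0 (number_data N).
Proof.
  split; intros a Ha; apply in_map_iff in Ha as (i & <- & _); [|simpl; lia].
  repeat split; try reflexivity. intros t [<-|[]]. eauto.
Qed.

Lemma history_input_data n : is_history 0 (input_data n).
Proof.
  split; intros a [<-|[]]; [|simpl; lia].
  repeat split; try reflexivity. intros t [].
Qed.

Lemma is_dataset_app X Y : is_dataset X -> is_dataset Y -> is_dataset (X ++ Y).
Proof. intros HX HY a Ha. apply in_app_iff in Ha as [Ha|Ha]; auto. Qed.

Lemma entails_ans_complete p n :
  eval p [n] 1 ->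
  exists N, entails (prog_with (compile p) (input_data n ++ number_data N)) (ans_fact 0).
Proof.
  (* Names up to [n] serve to read the input, the name of 1 to test the result, and [N] comes from
     the evaluation. *)
  intros H. destruct (rules_complete p _ _ H) as [N HN]. exists (2 + n + N).
  intros I HI. apply is_model_compile in HI as (Hd & Hr & Hf);
    [|apply is_dataset_app; [apply (history_input_data n)|apply update_number_data]].
  assert (Hnum : numbers (2 + n + N) I).
  { intros i Hi. apply Hf.
    exists (MkAtom val_pred [OConst i] (Some (TConst (Z.of_nat i + 1)))). split; [|reflexivity].
    apply in_app_iff; right. unfold number_data.
    apply (in_map (fun i => MkAtom val_pred [OConst i] (Some (TConst (Z.of_nat i + 1))))).
    apply in_seq. lia. }
  assert (Hp : I (graph_fact p [1; n])).
  { apply HN; [|exact Hr]. eapply numbers_le; [|exact Hnum]. lia. }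
  do 4 apply Forall_inv_tail in Hd. inversion Hd as [|? ? R1 Hd1]; subst.
  inversion Hd1 as [|? ? R2 Hd2]; subst. inversion Hd2 as [|? ? R3 _]; subst.
  (* Reading starts with zero at time [- n], hence reaches [n] exactly at time 0. *)
  assert (Hread : forall i, i <= n -> I (read_fact i (- Z.of_nat n + Z.of_nat i))).
  { induction i as [|i IH]; intros Hi.
    - simpl. rewrite Z.add_0_r.
      apply (R1 (MkSubst (fun _ => 0) (fun _ => (- Z.of_nat n)%Z))). repeat constructor.
      + apply Hf. eexists; split; [left; reflexivity|reflexivity].
      + apply (Hnum 0). lia.
    - rewrite Nat2Z.inj_succ, Z.add_succ_r, <- Z.add_1_r.
      (* Object variables 0 and 1 become [i] and [S i]; time variable 0 is the reading time, time
         variable 1 the naming time of [i]. *)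
      apply (R2 (MkSubst (fun x => x + i)
        (fun x => match x with O => - Z.of_nat n + Z.of_nat i | _ => Z.of_nat i + 1 end)%Z)).
      repeat constructor.
      + apply IH. lia.
      + apply (Hnum i). lia.
      + apply (numbers_succ _ _ i Hnum). lia. }
  apply (R3 (MkSubst (fun x => match x with 0 => 1 | _ => n end) (fun _ => 0%Z))).
  repeat constructor.
  - specialize (Hread n (le_n n)). now rewrite Z.add_opp_diag_l in Hread.
  - rewrite inst_graph_atom. exact Hp.
  - apply (Hnum 1). lia.
Qed.

(** * Forget on compiled instances *)

Definition input_instance (Q : query) (n : nat) : forget_instance :=
  MkFI Q (input_data n) 0 0 0.

Lemma valid_input_instance p n : valid_instance (input_instance (compiled_query p) n).
Proof.
  split; [|split; [apply history_input_data|simpl; lia]].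
  split; [|reflexivity]. split; [apply wf_compile|]. split; [reflexivity|].
  eexists. split; [right; right; left; reflexivity|left; reflexivity].
Qed.

Lemma update_pos U p l t : is_update 0 U -> holds U (p, l, Some t) -> (0 < t)%Z.
Proof.
  intros [HU Hpos] (a & Ha & E). destruct (HU a Ha) as [(_ & _ & Ht) _].
  specialize (Hpos a Ha). specialize (E (MkSubst (fun _ => 0) (fun _ => 0%Z))).
  unfold inst_atom in E. destruct (a_time a) as [[]|]; try contradiction.
  injection E as _ _ <-. exact Hpos.
Qed.

Lemma restrict_input_data n : restrict (input_data n) 0 = [].
Proof.
  unfold restrict, input_data; simpl. unfold keep_after; simpl.
  destruct (Z.ltb_spec 0 (- Z.of_nat n)); [lia|reflexivity].
Qed.

Lemma holds_app X Y g : holds (X ++ Y) g <-> holds X g \/ holds Y g.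
Proof.
  unfold holds. split.
  - intros (a & Ha & E). apply in_app_iff in Ha as [Ha|Ha]; [left|right]; eauto.
  - intros [(a & Ha & E)|(a & Ha & E)]; exists a; rewrite in_app_iff; auto.
Qed.

Lemma holds_input_data n g : holds (input_data n) g -> g = (inp_pred, [], Some (- Z.of_nat n)%Z).
Proof.
  intros (a & [<-|[]] & E). symmetry. apply (E (MkSubst (fun _ => 0) (fun _ => 0%Z))).
Qed.

Lemma holds_number_data N o t : holds (number_data N) (val_fact o t) -> t = (Z.of_nat o + 1)%Z.
Proof.
  intros (a & Ha & E). apply in_map_iff in Ha as (i & <- & _).
  specialize (E (MkSubst (fun _ => 0) (fun _ => 0%Z))). injection E as <- <-. reflexivity.
Qed.

Lemma forget_input_instance p n :
  forget_holds (input_instance (compiled_query p) n) <-> ~ eval p [n] 1.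
Proof.
  unfold forget_holds; cbn [fi_data fi_tin fi_tout fi_tmem fi_query input_instance].
  rewrite restrict_input_data. split.
  (* An evaluation to 1 provides an update whose answer at time 0 depends on the history. *)
  - intros H He. destruct (entails_ans_complete p n He) as [N HN].
    pose proof (update_number_data N) as HU.
    destruct (H _ HU 0%Z (Z.le_refl 0) []) as [H1 _].
    destruct H1 as [_ H1]; [split; [reflexivity|exact HN]|].
    revert H1. apply (not_entails_ans (number_data N)).
    + apply HU.
    + intros o t. apply update_pos, HU.
    + intros o t t' Ht Ht'. apply holds_number_data in Ht, Ht'. congruence.
    + intros m Hm. apply (update_pos _ _ _ _ HU) in Hm. lia.
  - intros Hn U HU tau Htau o. simpl app at 2. split.
    + intros [Ho H]. split; [exact Ho|]. destruct o; [clear Ho|discriminate Ho].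
      assert (HX : is_dataset (input_data n ++ U)).
      { apply is_dataset_app; [apply (history_input_data n)|apply HU]. }
      assert (Hval : forall o t, holds (input_data n ++ U) (val_fact o t) ->
        holds U (val_fact o t)).
      { intros o t Hot. apply holds_app in Hot as [Hot|Hot]; [|exact Hot].
        apply holds_input_data in Hot. discriminate Hot. }
      (* An ambiguous update entails every answer without the history; an unambiguous one entails
         none even with it. *)
      destruct (classic (exists o t t', holds U (val_fact o t) /\ holds U (val_fact o t') /\
        (t < t')%Z)) as [(o & t & t' & Ht & Ht' & Hlt)|Hamb].
      { apply (entails_ans_ambiguous _ _ o t t'); try assumption. apply HU. }
      exfalso. revert H. apply not_entails_ans; [exact HX|..].
      * intros o t Ht. eapply update_pos, Hval, Ht. exact HU.
      * intros o t t' Ht Ht'. apply Hval in Ht, Ht'.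
        destruct (Z.lt_trichotomy t t') as [L|[L|L]]; [|exact L|];
          exfalso; apply Hamb; eauto 8.
      * intros m Hm. apply holds_app in Hm as [Hm|Hm].
        -- apply holds_input_data in Hm. injection Hm as Hm. now replace m with n by lia.
        -- apply (update_pos _ _ _ _ HU) in Hm. lia.
    (* Monotonicity: every model for the full data is one for the update alone. *)
    + intros [Ho H]. split; [exact Ho|]. intros I HI. apply H. intros r s Hr.
      apply HI. unfold prog_with in *. rewrite map_app, !in_app_iff in *. tauto.
Qed.

(** * Self-application and diagonalization *)

Definition prf_instance : prf :=
  prf_cpair (PProj 0) (prf_cpair
    (prf_succ (prf_cpair
      (prf_cpair (prf_const (enc_pred inp_pred)) (prf_cpair (prf_const 0)
        (prf_succ (prf_cpair (prf_const 0)
          (PComp prf_pred [PComp prf_add [PProj 0; PProj 0]])))))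
      (prf_const 0)))
    (prf_const (cpair (enc_Z 0) (cpair (enc_Z 0) (enc_Z 0))))).

(** Negative integers have odd codes, and truncated subtraction covers [n = 0]; thus doubling
    followed by [prf_pred] computes the code of the input time. *)
Lemma enc_Z_opp n : enc_Z (- Z.of_nat n) = n + n - 1.
Proof. destruct n as [|n]; [reflexivity|]. simpl enc_Z. lia. Qed.

(** Only the query code and the input time vary in the instance code, and both are computed from the
    same argument. *)
Lemma eval_prf_instance Q :
  eval prf_instance [enc_query Q] (enc_instance (input_instance Q (enc_query Q))).
Proof.
  unfold enc_instance, enc_atom, input_instance, input_data.
  cbn [fi_data fi_tin fi_tout fi_tmem fi_query enc_list enc_option enc_tterm
    a_pred a_args a_time]. rewrite enc_Z_opp.
  unfold prf_instance.
  repeat (apply eval_const || apply eval_cpair || apply eval_succ).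
  - constructor. reflexivity.
  - eapply eval_comp1; [|apply eval_pred].
    eapply eval_comp2; [..|apply eval_add]; constructor; reflexivity.
Qed.

Theorem theorem7 : ~ forget_decidable.
Proof.
  (* [p] runs the decider on the instance whose query code and input are both its argument. *)
  intros [f Hf]. set (p := PComp f [prf_instance]).
  set (Q := compiled_query p). set (I := input_instance Q (enc_query Q)).
  assert (Hp : forall y, eval p [enc_query Q] y <-> eval f [enc_instance I] y).
  { intros y. split; [|apply eval_comp1, eval_prf_instance].
    intros H. inversion H as [| | |? ? ? ws ? Hs Hy| | |]; subst.
    inversion Hs as [|? ? ? w ? Hw Hnil]; subst. inversion Hnil; subst.
    now rewrite (eval_fun _ _ _ _ Hw (eval_prf_instance Q)) in Hy. }
  destruct (Hf I (valid_input_instance p _)) as [Hyes Hno].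
  assert (Hforget : forget_holds I <-> ~ eval f [enc_instance I] 1).
  { rewrite <- Hp. apply forget_input_instance. }
  (* If Forget held, [f] would return 1, which [Hforget] forbids. *)
  assert (Hn : ~ forget_holds I).
  { intros H. apply Hforget in H as H'. auto. }
  (* Since Forget fails, [f] returns 0 and so not 1, whence [Hforget] makes Forget hold. *)
  apply Hn, Hforget. intros H1. discriminate (eval_fun _ _ _ _ H1 (Hno Hn)).
Qed.
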